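(* 1. (Symmetric binary perceptron, SBP.) Let $0<\kappa'<\kappa$ and $\alpha>0$. There exists $d>0$ such that, with high probability, a $1-o_n(1)$ fraction of the SBP $\kappa'$-solutions lie in clusters of $\tilde S(G)$ (the SBP solution set with parameter $\kappa$) of diameter at least $dn$. 2. (Asymmetric binary perceptron, ABP.) Let $\kappa'>\kappa$ be real numbers and $\alpha>0$. There exists $d>0$ such that, with high probability, a $1-o_n(1)$ fraction of the ABP $\kappa'$-solutions lie in clusters of $S(G)$ (the ABP solution set with parameter $\kappa$) of diameter at least $dn$.
   Context: Let $\alpha>0$ and $m=\lfloor\alpha n\rfloor$. Let $G$ be a random $m\times n$ matrix with i.i.d. entries uniform on $\{+1,-1\}$. ABP model with parameter $\kappa\in\mathbb{R}$: the set of solutions is $$S(G)=\Big\{X\in\{-1,+1\}^n:\ \tfrac{1}{\sqrt n}\sum_{i=1}^n G_{j,i}X_i\ge\kappa\ \text{ for all } j=1,\dots,m\Big\}.$$ SBP model with parameter $\kappa>0$: the set of solutions is $$\tilde S(G)=\Big\{X\in\{-1,+1\}^n:\ \tfrac{1}{\sqrt n}\Big|\sum_{i=1}^n G_{j,i}X_i\Big|\le\kappa\ \text{ for all } j=1,\dots,m\Big\}.$$ In the SBP model, for $\kappa'>0$, a vector $X\in\{\pm1\}^n$ is a $\kappa'$-solution if $|GX|\le\kappa'\sqrt n$ holds entrywise. In the ABP model, for $\kappa'\in\mathbb{R}$, a vector $X\in\{\pm1\}^n$ is a $\kappa'$-solution if $GX\ge\kappa'\sqrt n$ holds entrywise. Two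 solutions (with parameter $\kappa$) are adjacent if they differ in exactly one coordinate. A cluster is a maximal connected component of the solution set ($S(G)$ for ABP, $\tilde S(G)$ for SBP) under this adjacency. The diameter of a cluster is the maximum Hamming distance between two of its elements. ''With high probability'' means with probability tending to $1$ as $n\to\infty$, with $\kappa,\kappa',\alpha$ fixed. ''A $1-o_n(1)$ fraction of the $\kappa'$-solutions has a property, with high probability'' means: there is a deterministic sequence $\delta_n\to0$ such that, with probability tending to $1$, the number of $\kappa'$-solutions without the property is at most $\delta_n$ times the total number of $\kappa'$-solutions (this is vacuous when there are no $\kappa'$-solutions). *)

(* Defs.v *)
(* MathComp-Analysis *)
From mathcomp Require Import all_boot all_order all_algebra.
From mathcomp Require Import boolp classical_sets reals topology normedtype sequences.
Import Order.TTheory GRing.Theory Num.Theory numFieldNormedType.Exports.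

Set Implicit Arguments.
Unset Strict Implicit.
Unset Printing Implicit Defensive.

Local Open Scope ring_scope.

(* Elements of {-1,+1} are encoded by booleans, [b] standing for [(-1) ^+ b];
   [pm A] is the genuine +1/-1 matrix encoded by the boolean matrix [A]. *)
Definition pm (R : pzRingType) (m n : nat) (A : 'M[bool]_(m, n)) : 'M[R]_(m, n) :=
  map_mx (fun b : bool => (-1) ^+ b) A.

(* The entries of G are independent, each of them +1 or -1 with probability
   1/2, so that the law of G gives a matrix the product of the weights of its
   entries. *)
Definition Pr (R : realType) (m n : nat) (E : {set 'M[bool]_(m, n)}) : R :=
  \sum_(G in E) \prod_(j < m) \prod_(i < n) 2^-1.

Definition nrows (R : realType) (alpha : R) (n : nat) : nat :=
  Num.truncn (alpha * n%:R).

Definition whp (R : realType) (alpha : R)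
    (E : forall n : nat, {set 'M[bool]_(nrows alpha n, n)}) : Prop :=
  ((fun n => Pr R (E n)) @ \oo --> (1 : R))%classic.

(* [abp_sol kappa' G] and [sbp_sol kappa' G] are also the sets of
   kappa'-solutions: dividing by [Num.sqrt n] changes nothing for [0 < n], and
   for [n = 0] the matrix G has no row. *)
Definition abp_sol (R : realType) (kappa : R) (m n : nat)
    (G : 'M[bool]_(m, n)) : {set 'cV[bool]_n} :=
  [set X | [forall j : 'I_m,
     kappa <= (Num.sqrt n%:R)^-1 * (pm R G *m pm R X) j 0]].

Definition sbp_sol (R : realType) (kappa : R) (m n : nat)
    (G : 'M[bool]_(m, n)) : {set 'cV[bool]_n} :=
  [set X | [forall j : 'I_m,
     (Num.sqrt n%:R)^-1 * `|(pm R G *m pm R X) j 0| <= kappa]].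

Definition hamming (n : nat) (X Y : 'cV[bool]_n) : nat :=
  #|[set i : 'I_n | X i 0 != Y i 0]|.

Definition adjacent_in (n : nat) (S : {set 'cV[bool]_n}) : rel 'cV[bool]_n :=
  [rel X Y | [&& X \in S, Y \in S & hamming X Y == 1%N]].

Definition clusters (n : nat) (S : {set 'cV[bool]_n}) : {set {set 'cV[bool]_n}} :=
  equivalence_partition (connect (adjacent_in S)) S.

Definition diameter (n : nat) (C : {set 'cV[bool]_n}) : nat :=
  \max_(X in C) \max_(Y in C) hamming X Y.

Definition in_wide_cluster (R : realType) (d : R) (n : nat)
    (S : {set 'cV[bool]_n}) (X : 'cV[bool]_n) : bool :=
  [exists C in clusters S, (X \in C) && (d * n%:R <= (diameter C)%:R)].

(* With high probability over G, a [1 - o(1)] fraction of [T G] satisfies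
   [P G]. *)
Definition whp_most (R : realType) (alpha : R)
    (T : forall m n : nat, 'M[bool]_(m, n) -> {set 'cV[bool]_n})
    (P : forall m n : nat, 'M[bool]_(m, n) -> pred 'cV[bool]_n) : Prop :=
  exists2 delta : nat -> R, (delta @ \oo --> (0 : R))%classic &
    @whp R alpha (fun n => [set G |
      #|[set X in T _ _ G | ~~ P _ _ G X]|%:R <= delta n * #|T _ _ G|%:R]).

(* Main.v *)
(* The conclusion holds for every matrix G and every kappa'-solution X once n is
   large.  Flipping the coordinates of X one by one along a list of columns
   changes each row of G X by twice the prefix sums of the vectors G_i X_i, so it
   suffices to find linearly many columns along which the prefix sums, with the
   row means removed, stay below a small multiple of sqrt n.

   A pigeonhole argument on the sums over dyadic intervals gives partial
   colourings by signs whose signed prefix sums are O(sqrt n), as in Spencer's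
   partial colouring method; fourth moments suffice for the counting.  Iterating
   on the uncoloured columns gives full colourings, with a bound that gains a
   power of k / n on lists of length k.  Since the rows have mean zero,
   Chobanyan's transference turns such colourings into an ordering of all the
   columns with prefix sums O(sqrt n).  Keeping one colour class halves the list
   and almost halves the prefix sums, so after finitely many halvings the
   constant in front of sqrt n is as small as desired. *)
Require Import Defs.
From mathcomp Require Import all_boot all_order all_algebra.
From mathcomp Require Import boolp classical_sets reals topology normedtype sequences exp.
From mathcomp Require Import ring lra zify.
Import Order.TTheory GRing.Theory Num.Theory numFieldNormedType.Exports.

Set Implicit Arguments.
Unset Strict Implicit.
Unset Printing Implicit Defensive.

Local Open Scope ring_scope.

(** * Moments of random signed sums *)

Definition sg (R : pzRingType) (b : bool) : R := (-1) ^+ b.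

Definition ssum (R : pzRingType) (T : finType) (c : T -> R) (r : seq T)
    (x : {ffun T -> bool}) : R :=
  \sum_(t <- r) sg R (x t) * c t.

Definition flip (T : finType) (p : T) (x : {ffun T -> bool}) : {ffun T -> bool} :=
  [ffun t => if t == p then ~~ x t else x t].

Lemma flipK (T : finType) (p : T) : involutive (flip p).
Proof.
by move=> x; apply/ffunP => t; rewrite !ffunE; case: eqP => // _; rewrite negbK.
Qed.

Lemma sgN (R : pzRingType) (b : bool) : sg R (~~ b) = - sg R b.
Proof. by rewrite /sg signrN. Qed.

Lemma norm_sg (R : numDomainType) (b : bool) : `|sg R b| = 1.
Proof. by rewrite /sg normrX normrN1 expr1n. Qed.

Lemma ssum_flip (R : pzRingType) (T : finType) (c : T -> R) (p : T) (r : seq T)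
    (x : {ffun T -> bool}) :
  p \notin r -> ssum c r (flip p x) = ssum c r x.
Proof.
move=> pr; apply: eq_big_seq => t tr; rewrite ffunE.
by case: eqP => // tp; rewrite -tp tr in pr.
Qed.

(** Pairing [x] with [flip p x] averages out the sign at [p]: the induction step for both
    moments. *)
Lemma sum_even (R : realFieldType) (T : finType) (c : T -> R) (p : T) (r : seq T)
    (F : R -> R) :
  p \notin r ->
  \sum_x F (ssum c (p :: r) x)
  = \sum_x (F (ssum c r x + c p) + F (ssum c r x - c p)) / 2.
Proof.
move=> pr.
have E x : F (ssum c (p :: r) x) + F (ssum c (p :: r) (flip p x))
    = F (ssum c r x + c p) + F (ssum c r x - c p).
  rewrite {1 2}/ssum !big_cons -/(ssum c r x) -/(ssum c r (flip p x)).
  rewrite ssum_flip // ffunE eqxx sgN /sg ![_ * c p + _]addrC.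
  case: (x p); rewrite ?expr0 ?expr1 ?opprK ?mulN1r ?mul1r //.
  exact: addrC.
rewrite -mulr_suml -(eq_bigr _ (fun x _ => E x)) big_split /=.
rewrite [X in _ + X](reindex_inj (inv_inj (flipK p))) /=.
under [X in _ + X]eq_bigr => x _ do rewrite flipK.
by rewrite -mulr2n -[_ *+ 2]mulr_natr mulfK // pnatr_eq0.
Qed.

Lemma sum_ssum2 (R : realFieldType) (T : finType) (c : T -> R) (r : seq T) :
  uniq r ->
  \sum_x ssum c r x ^+ 2 = (\sum_(t <- r) c t ^+ 2) *+ #|{ffun T -> bool}|.
Proof.
elim: r => [_|p r IH /= /andP[pr ur]].
  by rewrite big_nil mul0rn big1 // => x _; rewrite /ssum big_nil expr0n.
rewrite (sum_even c (fun z => z ^+ 2) pr) big_cons mulrnDl -IH // addrC -sumr_const.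
by rewrite -big_split; apply: eq_bigr => x _ /=; field.
Qed.

(** One more sign cancels the odd powers and adds [6 c^2 s + c^4] to the average, at most the growth
    of [3 s^2] when [s] becomes [s + c^2]. *)
Lemma sum_ssum4 (R : realFieldType) (T : finType) (c : T -> R) (r : seq T) :
  uniq r ->
  \sum_x ssum c r x ^+ 4
  <= (3 * (\sum_(t <- r) c t ^+ 2) ^+ 2) *+ #|{ffun T -> bool}|.
Proof.
elim: r => [_|p r IH /= /andP[pr ur]].
  rewrite big_nil expr0n mulr0 mul0rn big1 // => x _.
  by rewrite /ssum big_nil expr0n.
rewrite (sum_even c (fun z => z ^+ 4) pr) big_cons.
set s := \sum_(t <- r) _ in IH *.
have -> : \sum_x ((ssum c r x + c p) ^+ 4 + (ssum c r x - c p) ^+ 4) / 2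
  = \sum_x ssum c r x ^+ 4 + 6 * c p ^+ 2 * \sum_x ssum c r x ^+ 2
    + c p ^+ 4 *+ #|{ffun T -> bool}|.
  by rewrite -sumr_const mulr_sumr -!big_split; apply: eq_bigr => x _ /=; field.
rewrite (sum_ssum2 c ur) -/s.
have {IH} := IH ur; set A := \sum_x _ ^+ 4.
rewrite -[s *+ _]mulr_natr -[c p ^+ 4 *+ _]mulr_natr -[3 * (_ + _) ^+ 2 *+ _]mulr_natr.
rewrite -[3 * _ *+ _]mulr_natr.
have := ler0n R #|{ffun T -> bool}|; set K := _%:R => K0 HA.
have c4 : 0 <= c p ^+ 4 * K by rewrite mulr_ge0 // exprn_even_ge0.
have -> : 3 * (c p ^+ 2 + s) ^+ 2 * K
  = 3 * s ^+ 2 * K + 6 * c p ^+ 2 * (s * K) + (3 * (c p ^+ 4 * K)) by ring.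
by apply: lerD; [apply: lerD|rewrite ler_peMl // ler1n].
Qed.

(** * Two distant sign vectors with the same code *)

(** Give [y] the weight [3^-dist(x0, y)]: the total factors into [(1 + 1/3)^#|T|], and a point of
    the ball weighs at least [3^-d]. *)
Lemma card_hamming_ball (R : realFieldType) (T : finType) (x0 : {ffun T -> bool})
    (d : nat) (A : {set {ffun T -> bool}}) :
  (forall y, y \in A -> (#|[set t | x0 t != y t]| <= d)%N) ->
  #|A|%:R <= 3 ^+ d * (4 / 3) ^+ #|T| :> R.
Proof.
move=> Ad.
have <- : \sum_(y : {ffun T -> bool}) \prod_t (if x0 t != y t then 3^-1 else 1)
    = (4 / 3) ^+ #|T| :> R.
  rewrite -(bigA_distr_bigA (fun t b => if x0 t != b then 3^-1 else 1)) /=.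
  rewrite -prodr_const; apply: eq_bigr => t _.
  by rewrite big_bool; case: (x0 t) => /=; field.
have dist (y : {ffun T -> bool}) : \prod_t (if x0 t != y t then 3^-1 else 1)
    = 3^-1 ^+ #|[set t | x0 t != y t]| :> R.
  rewrite -big_mkcond /= -prodr_const; apply: eq_bigl => t.
  by rewrite inE.
have A0 (y : {ffun T -> bool}) : 0 <= \prod_t (if x0 t != y t then 3^-1 else 1) :> R.
  by rewrite dist exprn_ge0 // invr_ge0.
rewrite mulr_sumr [leRHS](bigID (mem A)) /= -[leLHS]addr0; apply: lerD; last first.
  by apply: sumr_ge0 => y _; rewrite mulr_ge0 // exprn_ge0.
rewrite -sum1_card natr_sum; apply: ler_sum => y yA.
rewrite dist exprVn ler_pdivlMr ?mul1r ?exprn_gt0 //.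
by rewrite ler_eXn2l ?Ad // ltr1n.
Qed.

(* Kraft's inequality bounds the exponential weights of all the codes by 1 and
   Jensen's bounds their average over X from below, so some code is shared. *)
Lemma kraft_pigeonhole (R : realType) (X I K : finType) (code : X -> I -> K)
    (cost : I -> K -> R) (a : R) :
  (0 < #|X|)%N ->
  (forall i, \sum_k expR (- cost i k) <= 1) ->
  \sum_x \sum_i cost i (code x i) <= a * #|X|%:R ->
  exists x0, expR (- a) * #|X|%:R
     <= #|[set x | [forall i, code x i == code x0 i]]|%:R.
Proof.
move=> /card_gt0P[x1 _] kraft avg.
pose cod x := [ffun i => code x i].
pose cl (x : X) := #|[set y | cod y == cod x]|.
(* [x0] has the most populous code, so [cl x0] bounds every code class. *)
have [x0 _ x0max] := @arg_maxnP X x1 xpredT cl isT.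
exists x0.
have -> : [set x | [forall i, code x i == code x0 i]] = [set y | cod y == cod x0].
  apply/setP => x; rewrite !inE; apply/forallP/eqP => [e|e i].
    by apply/ffunP => i; rewrite !ffunE; apply/eqP.
  by move/ffunP: e => /(_ i); rewrite !ffunE => ->.
rewrite -/(cl x0).
have W : \sum_x expR (- \sum_i cost i (code x i)) <= (cl x0)%:R.
  rewrite (partition_big cod xpredT) //=.
  apply: (@le_trans _ _ (\sum_(q : {ffun I -> K}) (cl x0)%:R * \prod_i expR (- cost i (q i)))).
    apply: ler_sum => q _.
    rewrite [leLHS](eq_bigr (fun=> \prod_i expR (- cost i (q i)))); last first.
      move=> x /eqP <-; rewrite -sumrN expR_sum.
      by apply: eq_bigr => i _; rewrite ffunE.
    rewrite sumr_const -[leLHS]mulr_natl ler_wpM2r //.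
      by apply: prodr_ge0 => i _; rewrite expR_ge0.
    rewrite ler_nat.
    have [->//|] := posnP #|[pred x | cod x == q]|.
    move=> /card_gt0P[x]; rewrite inE => /eqP <-; apply: leq_trans (x0max x isT).
    by apply: eq_leq; apply: eq_card => y; rewrite !inE.
  rewrite -mulr_sumr -(bigA_distr_bigA (fun i k => expR (- cost i k))) /=.
  rewrite ler_piMr //; apply: prodr_ile1 => i _; rewrite kraft andbT.
  by apply: sumr_ge0 => k _; rewrite expR_ge0.
apply: le_trans W.
(* Jensen in tangent form: [expR (a - c) >= 1 + a - c], whose average over [X] is at least 1 by
   [avg]. *)
apply: (@le_trans _ _ (\sum_x expR (- a) * (1 + a - \sum_i cost i (code x i)))).
  rewrite -mulr_sumr ler_wpM2l ?expR_ge0 // sumrB sumr_const -mulr_natr.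
  by move: avg; lra.
apply: ler_sum => x _.
set c := \sum_i _.
have -> : expR (- c) = expR (- a) * expR (a - c) by rewrite -expRD addKr.
by rewrite ler_wpM2l ?expR_ge0 // -addrA expR_ge1Dx.
Qed.

Lemma geometric_sum_le (R : realFieldType) (p : R) (m : nat) :
  0 <= p -> p <= 1 / 8 -> \sum_(n < m) p ^+ n.+1 <= 8 / 7 * p.
Proof.
move=> p0 p8.
suff H : \sum_(n < m) p ^+ n.+1 <= 8 / 7 * (p - p ^+ m.+1).
  by apply: le_trans H _; have := exprn_ge0 m.+1 p0; lra.
elim: m => [|m IH]; first by rewrite big_ord0 expr1 subrr mulr0.
rewrite big_ord_recr /=; have : 0 <= p ^+ m.+1 by rewrite exprn_ge0.
by rewrite [p ^+ m.+2]exprS; move: IH p0 p8; nra.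
Qed.

(* Truncation towards 0 merges the two signs around 0 into the single cell
   [inl tt], so that a typical sum has a code of almost no cost. *)
Definition cell (R : realType) (D : R) (B : nat) (s : R) : unit + bool * 'I_B.+1 :=
  if Num.truncn (`|s| / D) is n.+1 then inr (s < 0, inord n) else inl tt.

(** Either both sums lie in [(-D, D)], or they share their sign and their absolute values lie in a
    common interval of length [D]; the bounds by [B] keep [inord] faithful. *)
Lemma cell_close (R : realType) (D : R) (B : nat) (s s' : R) :
  0 < D -> (Num.truncn (`|s| / D) <= B)%N -> (Num.truncn (`|s'| / D) <= B)%N ->
  cell D B s = cell D B s' -> `|s - s'| <= 2 * D.
Proof.
move=> D0.
have sD (z : R) : 0 <= `|z| / D by rewrite divr_ge0 // ltW.
have itv (z : R) (n : nat) : Num.truncn (`|z| / D) = n ->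
    n%:R * D <= `|z| < n.+1%:R * D.
  by move=> <-; rewrite -ler_pdivlMr // -ltr_pdivrMr //; apply: truncn_itv.
rewrite /cell; case En : (Num.truncn (`|s| / D)) => [|n];
  case En' : (Num.truncn (`|s'| / D)) => [|n'] // nB nB'.
  move=> _; have := itv _ _ En; have := itv _ _ En'.
  rewrite mul0r !normr_ge0 !mul1r /= => h h'.
  by apply: le_trans (ler_normB _ _) _; lra.
case=> sg_eq nn'.
have {nn'} nn' : n = n'.
  by move/(congr1 val): nn'; rewrite /= !inordK // ltnS ltnW.
rewrite -{}nn' in En' nB'.
have := itv _ _ En; have := itv _ _ En'; rewrite -!natr1 !mulrDl !mul1r.
set N := n%:R * D; move=> /andP[a1 a2] /andP[b1 b2].
rewrite ler_norml; apply/andP; move: a1 a2 b1 b2.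
case: (ltP s 0) sg_eq => hs; case: (ltP s' 0) => hs' // _.
  by rewrite !ltr0_norm //; split; lra.
by rewrite !ger0_norm //; split; lra.
Qed.

(** With [p = expR (- L)], the two outer cells of index [n] have Kraft weight [p^(n+1)] each. For
    [p <= 1/8] the cost [8 p] of the central cell brings its weight below [1 - 4 p], which leaves
    room for both geometric series. *)
Definition cell_cost (R : realType) (L : R) (B : nat) (k : unit + bool * 'I_B.+1) : R :=
  match k with inl _ => 8 * expR (- L) | inr (_, n) => L * n.+1%:R end.

Lemma cell_kraft (R : realType) (L : R) (B : nat) :
  expR (- L) <= 1 / 8 ->
  \sum_(k : unit + bool * 'I_B.+1) expR (- cell_cost L k) <= 1.
Proof.
move=> L8; set p := expR (- L) in L8; have p0 : 0 <= p by apply: expR_ge0.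
rewrite big_sumType /= (big_pred1 tt) /=; last by case.
rewrite (eq_bigr (fun bn : bool * 'I_B.+1 => p ^+ bn.2.+1)); last first.
  by case=> b n _ /=; rewrite -mulNr expRM_natr.
rewrite -(pair_bigA _ (fun (b : bool) (n : 'I_B.+1) => p ^+ n.+1)) /= big_bool /= -/p.
have := geometric_sum_le B.+1 p0 L8; set S := \sum_(i < _) _ => HS.
have h8 : 0 < 1 + 8 * p by rewrite ltr_wpDr // mulr_ge0.
have : expR (- (8 * p)) <= (1 + 8 * p)^-1.
  by rewrite expRN lef_pV2 ?posrE ?expR_gt0 // expR_ge1Dx.
have : (1 + 8 * p)^-1 <= 1 - 4 * p.
  by rewrite -[leLHS]mul1r ler_pdivrMr //; nra.
by move: HS; lra.
Qed.

(** An outer cell of index [n] forces [1 <= n + 1 <= |s| / D], hence [n + 1 <= (|s| / D)^4]; this is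
    where fourth moments enter. *)
Lemma cell_cost_le (R : realType) (L D : R) (B : nat) (s : R) :
  0 < D -> 0 <= L -> (Num.truncn (`|s| / D) <= B)%N ->
  cell_cost L (cell D B s) <= 8 * expR (- L) + L * (s ^+ 4 / D ^+ 4).
Proof.
move=> D0 L0.
have sD : 0 <= `|s| / D by rewrite divr_ge0 // ltW.
have := truncn_itv sD; rewrite /cell.
have e0 := expR_ge0 (- L).
have -> : s ^+ 4 / D ^+ 4 = (`|s| / D) ^+ 4.
  by rewrite expr_div_n -normrX ger0_norm // exprn_even_ge0.
case: (Num.truncn _) => [|n] /andP[nle _] nB /=.
  by rewrite lerDl mulr_ge0 // exprn_ge0.
rewrite inordK ?ltnS 1?ltnW //; apply: ler_wpDl; first by rewrite mulr_ge0.
apply: ler_wpM2l => //; apply: le_trans (nle) _.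
rewrite -[leLHS]expr1 ler_weXn2l //.
by apply: le_trans nle; rewrite ler1n.
Qed.

(** Numerically, [3 <= 1.33^4], [1.33 * 4/3 < 1.8] and [0.9 <= expR (-1/10)]. *)
Lemma ball_lt_class (R : realType) (d k : nat) :
  (d * 4 <= k)%N -> (0 < k)%N ->
  3 ^+ d * (4 / 3) ^+ k < expR (- (1 / 10 * k%:R)) * 2 ^+ k :> R.
Proof.
move=> dk k0; apply: (@le_lt_trans _ _ ((133 / 100) ^+ k * (4 / 3) ^+ k)).
  rewrite ler_wpM2r ?exprn_ge0 ?divr_ge0 //.
  apply: (@le_trans _ _ ((133 / 100) ^+ (d * 4))); last first.
    by rewrite ler_weXn2l //; lra.
  by rewrite mulnC exprM; apply: lerXn2r; rewrite ?nnegrE; lra.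
apply: (@lt_le_trans _ _ ((9 / 10) ^+ k * 2 ^+ k)).
  by rewrite -!exprMn ltrXn2r -?lt0n ?k0 //; lra.
rewrite ler_wpM2r ?exprn_ge0 // -mulNr expRM_natr lerXn2r ?nnegrE ?expR_ge0 //; last first.
  by apply: le_trans (expR_ge1Dx _); lra.
lra.
Qed.

(** The average cost is at most [#|P| / 10], so some code is shared by at least
    [expR (- #|P| / 10) * 2^#|P|] vectors, too many for a Hamming ball of radius below
    [#|P| / 4]. *)
Lemma pigeonhole_coloring (R : realType) (I P : finType) (c : I -> P -> R)
    (D L : I -> R) :
  (0 < #|P|)%N -> (forall i, 0 < D i) -> (forall i, expR (- L i) <= 1 / 8) ->
  \sum_i (8 * expR (- L i) + L i * (3 * (\sum_t c i t ^+ 2) ^+ 2 / D i ^+ 4))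
    <= 1 / 10 * #|P|%:R ->
  exists x x' : {ffun P -> bool},
    (#|P| <= 4 * #|[set t | x t != x' t]|)%N /\
    forall i, `|\sum_t (sg R (x t) - sg R (x' t)) * c i t| <= 2 * D i.
Proof.
move=> P0 D0 L8 cost_le.
have L0 i : 0 <= L i.
  rewrite -oppr_le0 -ler_expR expR0; apply: le_trans (L8 i) _; lra.
pose S i x := ssum (c i) (index_enum P) x.
(* [B] bounds every quotient that occurs, so [inord] never falls back to its default. *)
pose B := \max_i \max_x Num.truncn (`|S i x| / D i).
have SB i x : (Num.truncn (`|S i x| / D i) <= B)%N.
  apply: leq_trans (leq_bigmax i).
  exact: (leq_bigmax (F := fun x => Num.truncn (`|S i x| / D i)) x).
pose code x i := cell (D i) B (S i x).
set X : finType := ({ffun P -> bool} : finType).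
have X0 : (0 < #|X|)%N by rewrite card_ffun expn_gt0 card_bool.
have [||x0 Hx0] := @kraft_pigeonhole R X I _ code (fun i => @cell_cost R (L i) B)
    (1 / 10 * #|P|%:R) X0.
- by move=> i; apply: cell_kraft.
- rewrite exchange_big /=.
  move: cost_le => /(ler_wpM2r (ler0n R #|X|)); apply: le_trans.
  rewrite mulr_suml; apply: ler_sum => i _.
  apply: (@le_trans _ _ (\sum_x (8 * expR (- L i) + L i * (S i x ^+ 4 / D i ^+ 4)))).
    by apply: ler_sum => x _; apply: cell_cost_le.
  rewrite big_split /= sumr_const -[_ *+ _]mulr_natr [leRHS]mulrDl; apply: lerD => //.
  rewrite -mulr_sumr -mulr_suml -[leRHS]mulrA ler_wpM2l // [leRHS]mulrAC.
  apply: ler_wpM2r; first by rewrite invr_ge0 exprn_ge0 // ltW.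
  by have := sum_ssum4 (c i) (index_enum_uniq P); rewrite -[_ *+ _]mulr_natr.
apply: contrapT => noX.
(* Failing [#|P| <= 4 * dist] means that [dist] is at most [(#|P| - 1) / 4] rounded down. *)
have near y : y \in [set x | [forall i, code x i == code x0 i]] ->
    (#|[set t | x0 t != y t]| <= (#|P|.-1) %/ 4)%N.
  rewrite inE => /forallP same; rewrite leqNgt; apply/negP => far; apply: noX.
  exists x0, y; split.
    move: far; rewrite -ltnS ltnS ltn_divLR // mulnC; case: #|P| P0 => // m _ /=.
  move=> i; have /eqP := same i; rewrite /code => e.
  have := cell_close (D0 i) (SB i x0) (SB i y) (esym e).
  by rewrite /S /ssum -sumrB; under eq_bigr do rewrite -mulrBl.
have := card_hamming_ball R near; set M := #|_|%:R in Hx0 *.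
move=> Mle; move: (le_trans Hx0 Mle); apply/negP; rewrite -ltNge card_ffun card_bool natrX.
apply: ball_lt_class => //; apply: leq_trans (leq_trunc_div _ _) (leq_pred _).
Qed.

(** * Dyadic intervals and partial colourings *)

(** The binary expansion of [t] cuts its prefix into at most one dyadic interval per level. *)
Lemma prefix_dyadic (R : realFieldType) (k M : nat) (f : 'I_k -> R) (D : nat -> R) (t : nat) :
  (forall l, 0 <= D l) ->
  (k <= 2 ^ M)%N -> (t <= k)%N ->
  (forall l a, (l <= M)%N -> (a < k %/ 2 ^ l)%N ->
     `|\sum_(p < k | (a * 2 ^ l <= p < a.+1 * 2 ^ l)%N) f p| <= D l) ->
  `|\sum_(p < k | (p < t)%N) f p| <= \sum_(l < M.+1) D l.
Proof.
move=> D0 kM tk HD.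
(* Downward induction on [l], from [M + 1], where [t] rounds down to 0; an odd quotient splits off
   one interval of length [2^l]. *)
suff H i l : (l + i)%N = M.+1 ->
    `|\sum_(p < k | (p < t %/ 2 ^ l * 2 ^ l)%N) f p| <= \sum_(l <= l' < M.+1) D l'.
  by have := H M.+1 0%N (add0n _); rewrite expn0 divn1 muln1 big_mkord.
elim: i l => [|i IH] l.
  rewrite addn0 => ->; rewrite divn_small ?mul0n; last first.
    by rewrite (leq_ltn_trans tk) // (leq_ltn_trans kM) // ltn_exp2l.
  by rewrite big_pred0 // normr0 big_geq.
move=> lM; have lM' : (l <= M)%N by rewrite -ltnS -lM addnS ltnS leq_addr.
rewrite big_ltn ?ltnS //.
have {IH} := IH l.+1; rewrite addSn -addnS => /(_ lM).
have : (t %/ 2 ^ l <= k %/ 2 ^ l)%N by rewrite leq_div2r.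
rewrite expnSr divnMA divn2; set q := (t %/ 2 ^ l)%N => qk.
rewrite [(2 ^ l * 2)%N]mulnC mulnA muln2 => IH.
rewrite -{1}(odd_double_half q); case qodd : (odd q); last first.
  by rewrite add0n; apply: le_trans IH _; rewrite lerDr.
set a := q./2.*2 in IH *; rewrite add1n.
have ak : (a < k %/ 2 ^ l)%N.
  by rewrite -(odd_double_half q) qodd add1n in qk.
rewrite (bigID (fun p : 'I_k => (a * 2 ^ l <= p)%N)) /=.
apply: le_trans (ler_normD _ _) _; apply: lerD.
  rewrite (eq_bigl (fun p : 'I_k => (a * 2 ^ l <= p < a.+1 * 2 ^ l)%N)) ?HD // => p.
  by rewrite andbC.
rewrite (eq_bigl (fun p : 'I_k => (p < a * 2 ^ l)%N)) // => p.
rewrite -ltnNge; apply/andP/idP => [[]//|h]; split=> //.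
by apply: leq_trans h _; rewrite leq_mul2r leqnSn orbT.
Qed.

Lemma card_ord_interval (k lo hi : nat) :
  (#|[set p : 'I_k | (lo <= p < hi)%N]| <= hi - lo)%N.
Proof.
rewrite cardE -(size_map val) -[leqRHS](size_iota lo); apply: uniq_leq_size.
  by rewrite (map_inj_uniq val_inj) enum_uniq.
move=> x /mapP[p]; rewrite mem_enum inE => /andP[p1 p2] ->.
by rewrite mem_iota p1 subnKC // ltnW // (leq_ltn_trans p1).
Qed.

Lemma sum_geometric_succ_le (R : realFieldType) (x : R) (n : nat) :
  0 <= x -> x < 1 -> \sum_(r < n) r.+1%:R * x ^+ r <= ((1 - x) ^+ 2)^-1.
Proof.
move=> x0 x1; rewrite -[leRHS]mul1r ler_pdivlMr ?exprn_gt0 ?subr_gt0 //.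
suff -> : (\sum_(r < n) r.+1%:R * x ^+ r) * (1 - x) ^+ 2
    = 1 - (1 + n%:R * (1 - x)) * x ^+ n.
  by rewrite gerBl mulr_ge0 ?exprn_ge0 ?addr_ge0 ?mulr_ge0 // subr_ge0 ltW.
elim: n => [|n IH]; first by rewrite big_ord0 !mul0r addr0 expr0 mulr1 subrr.
by rewrite big_ord_recr /= mulrDl IH -[n.+1%:R]natr1 [x ^+ n.+1]exprS; ring.
Qed.

Lemma sum_geometric_le (R : realFieldType) (x : R) (n : nat) :
  0 <= x -> x < 1 -> \sum_(r < n) x ^+ r <= (1 - x)^-1.
Proof.
move=> x0 x1; rewrite -[leRHS]mul1r ler_pdivlMr ?subr_gt0 // mulrC.
by rewrite -opprB mulNr -subrX1 opprB gerBl exprn_ge0.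
Qed.

Lemma sum_rev_le (R : realFieldType) (F : nat -> R) (M N : nat) (c : R) :
  (M <= N)%N -> (forall r, 0 <= F r) -> (forall n, \sum_(r < n) F r <= c) ->
  \sum_(l < M.+1) F (N - l)%N <= c.
Proof.
move=> MN F0 Fc; apply: le_trans (Fc N.+1).
rewrite [leRHS](reindex_inj rev_ord_inj) /=.
rewrite [leRHS](eq_bigr (fun l : 'I_N.+1 => F (N - l)%N)); last first.
  by move=> l _; rewrite subSS.
rewrite (big_ord_widen N.+1 (fun l => F (N - l)%N)) ?ltnS //.
by rewrite [leRHS](bigID (fun l : 'I_N.+1 => (l < M.+1)%N)) /= lerDl sumr_ge0.
Qed.

(** Used at level [l] with [r = N - l]. The ratio [1 / (4 (9/10)^4)] is [5000/6561 * 1/2]; the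
    factor [(1/2)^r] is kept apart to cancel the number of intervals, which grows like [2^r]. *)
Lemma level_cost_le (R : realType) (A b x : R) (r l : nat) :
  0 < b -> 0 <= A -> expR (- A) <= 1 / 4 -> 0 <= x -> x <= 4 * 2 ^+ l ->
  8 * expR (- (A * r.+1%:R))
    + A * r.+1%:R * (3 * x ^+ 2 / (b * Num.sqrt (2 ^+ (l + r)) * (9 / 10) ^+ r) ^+ 4)
  <= (8 * expR (- A) * (1 / 2) ^+ r
      + 48 * A / b ^+ 4 * (r.+1%:R * (5000 / 6561) ^+ r)) * (1 / 2) ^+ r.
Proof.
move=> b0 A0 A4 x0 xl; rewrite [leRHS]mulrDl; apply: lerD.
  rewrite -mulNr expRM_natr exprS -!mulrA ler_wpM2l // ler_wpM2l ?expR_ge0 //.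
  by rewrite -exprMn lerXn2r ?nnegrE ?expR_ge0 //; lra.
have -> : (b * Num.sqrt (2 ^+ (l + r)) * (9 / 10) ^+ r) ^+ 4
    = b ^+ 4 * (2 ^+ l) ^+ 2 * ((2 ^+ r) ^+ 2 * ((9 / 10) ^+ r) ^+ 4).
  rewrite !exprMn -[4%N]/(2 * 2)%N [Num.sqrt _ ^+ _]exprM sqr_sqrtr ?exprn_ge0 //.
  by rewrite exprD exprMn; ring.
set y := 2 ^+ l in xl *; have y0 : 0 < y by rewrite exprn_gt0.
have zE : (5000 / 6561 : R) ^+ r * (1 / 2) ^+ r = ((2 ^+ r) ^+ 2 * ((9 / 10) ^+ r) ^+ 4)^-1.
  rewrite -!exprM [(r * 2)%N]mulnC [(r * 4)%N]mulnC !exprM -!exprMn -exprVn.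
  by congr (_ ^+ r); field.
set z := (_ ^+ 2 * _)^-1 in zE *; have z0 : 0 <= z by rewrite invr_ge0 mulr_ge0 ?exprn_ge0 // divr_ge0.
have x2 : x ^+ 2 / y ^+ 2 <= 16.
  rewrite ler_pdivrMr ?exprn_gt0 // (_ : 16 = 4 ^+ 2) -?exprMn; last by ring.
  by rewrite lerXn2r ?nnegrE // mulr_ge0 // ltW.
have b4 : 0 < b ^+ 4 by rewrite exprn_gt0.
have -> : A * r.+1%:R * (3 * x ^+ 2 / (b ^+ 4 * y ^+ 2 * ((2 ^+ r) ^+ 2 * ((9 / 10) ^+ r) ^+ 4)))
    = 3 * (A * r.+1%:R / b ^+ 4 * z) * (x ^+ 2 / y ^+ 2).
  by rewrite /z !invfM; ring.
have -> : 48 * A / b ^+ 4 * (r.+1%:R * (5000 / 6561) ^+ r) * (1 / 2) ^+ r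
    = 3 * (A * r.+1%:R / b ^+ 4 * z) * 16.
  by rewrite -zE; ring.
by rewrite ler_wpM2l // !mulr_ge0 // invr_ge0 ltW.
Qed.

(** [A] comes first, using [expR (- A) <= 1 / A], then [b] in terms of [A]. Each term gets [1/20],
    whence [320 = 20 * 16] and [17280 = 20 * 864]. *)
Lemma coloring_constants (R : realType) (alpha : R) : 0 < alpha ->
  exists A b : R, [/\ 0 < A, 0 < b, expR (- A) <= 1 / 8 &
    (16 * expR (- A) + 864 * A / b ^+ 4) * alpha <= 1 / 10].
Proof.
move=> alpha0; pose A := 8 + 320 * alpha.
have A8 : 8 <= A by rewrite /A; lra.
have Aalpha : 320 * alpha <= A by rewrite /A; lra.
clearbody A; have A0 : 0 < A by lra.
have expA : expR (- A) <= A^-1.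
  rewrite expRN lef_pV2 ?posrE ?expR_gt0 //; apply: le_trans (expR_ge1Dx _); lra.
have aA := mulr_gt0 alpha0 A0.
pose b := 1 + 17280 * (alpha * A).
have b1 : 1 <= b by rewrite /b; lra.
have bA : 17280 * (alpha * A) <= b by rewrite /b; lra.
clearbody b; have b0 : 0 < b by lra.
have b4 : b <= b ^+ 4 by rewrite -[leLHS]expr1 ler_weXn2l.
exists A, b; split=> //.
  by apply: le_trans expA _; rewrite -[1 / 8]invf_div lef_pV2 ?posrE //; lra.
rewrite mulrDl; have -> : 1 / 10 = 1 / 20 + 1 / 20 :> R by field.
apply: lerD.
  apply: (@le_trans _ _ (16 * A^-1 * alpha)).
    by apply: ler_wpM2r; [exact: ltW|rewrite ler_wpM2l].
  by rewrite mulrAC ler_pdivrMr //; lra.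
by rewrite mulrAC ler_pdivrMr ?exprn_gt0 //; lra.
Qed.

Lemma level_costs_sum_le (R : realType) (A b : R) (n : nat) :
  0 < A -> 0 < b ->
  \sum_(r < n) (8 * expR (- A) * (1 / 2) ^+ r
      + 48 * A / b ^+ 4 * (r.+1%:R * (5000 / 6561) ^+ r))
  <= 16 * expR (- A) + 864 * A / b ^+ 4.
Proof.
move=> A0 b0; rewrite big_split /= -!mulr_sumr.
(* The two series are at most 2 and [(6561/1561)^2 < 18]. *)
have -> : 16 * expR (- A) + 864 * A / b ^+ 4
  = 8 * expR (- A) * 2 + 48 * A / b ^+ 4 * 18 by ring.
apply: lerD; apply: ler_wpM2l; rewrite ?mulr_ge0 ?expR_ge0 ?invr_ge0 ?exprn_ge0 ?(ltW A0) ?(ltW b0) //.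
  by apply: le_trans (sum_geometric_le _ _ _) _; [lra|lra|rewrite -[leLHS]mul1r ler_pdivrMr; lra].
by apply: le_trans (sum_geometric_succ_le _ _ _) _; [lra|lra|rewrite -[leLHS]mul1r ler_pdivrMr; lra].
Qed.

Lemma sum_rev_9_10 (R : realFieldType) (M : nat) :
  \sum_(l < M.+1) (9 / 10 : R) ^+ (M - l) <= 10.
Proof.
apply: (sum_rev_le (F := fun r => (9 / 10 : R) ^+ r)) => // [r|n].
  by rewrite exprn_ge0 // divr_ge0.
by apply: le_trans (sum_geometric_le _ _ _) _; [lra|lra|rewrite -[leLHS]mul1r ler_pdivrMr; lra].
Qed.

(* Dyadic intervals of length 2 ^ (N - r) are allowed sums of order
   (9/10) ^ r * sqrt (2 ^ N).  Any ratio rho < 1 with 2 rho ^ 4 > 1 would do: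
   the first condition makes the allowances summable, the second the costs. *)
Lemma prefix_partial_coloring (R : realType) (alpha : R) : 0 < alpha ->
  exists2 b : R, 0 < b &
  forall (N M k : nat) (J : finType) (v : J -> 'I_k -> R),
    (M <= N)%N -> (0 < k)%N -> (k <= 2 ^ M)%N ->
    #|J|%:R <= alpha * 2 ^+ N -> (forall j p, `|v j p| <= 2) ->
    exists x x' : {ffun 'I_k -> bool},
      (k <= 4 * #|[set p | x p != x' p]|)%N /\
      forall j t, (t <= k)%N ->
        `|\sum_(p < k | (p < t)%N) (sg R (x p) - sg R (x' p)) * v j p|
        <= b * Num.sqrt (2 ^+ N) * (9 / 10) ^+ (N - M).
Proof.
move=> alpha0; have [A [b [A0 b0 A8 Ab]]] := coloring_constants alpha0.
have A4 : expR (- A) <= 1 / 4 by lra.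
(* [20 = 2 * 10]: a shared cell gives [2 * D], and the powers of [9/10] sum to at most 10. *)
exists (20 * b); first by rewrite mulr_gt0.
move=> N M k J v MN k0 kM Jle v2.
pose Q : R := Num.sqrt (2 ^+ N).
have Q0 : 0 < Q by rewrite sqrtr_gt0 exprn_gt0.
pose D (l : nat) := b * Q * (9 / 10) ^+ (N - l).
have D0 l : 0 < D l by rewrite !mulr_gt0 ?exprn_gt0 ?divr_gt0.
(* An index is a row, a level and a dyadic interval of that level lying entirely inside [[0, k)]. *)
pose I : finType := (J * {l : 'I_M.+1 & 'I_(k %/ 2 ^ l)})%type.
pose lev (i : I) : nat := tag i.2.
pose pos (i : I) : nat := tagged i.2.
pose inI (i : I) (p : 'I_k) := (pos i * 2 ^ lev i <= p < (pos i).+1 * 2 ^ lev i)%N.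
pose c (i : I) (p : 'I_k) := if inI i p then v i.1 p else 0.
pose L (i : I) := A * (N - lev i).+1%:R.
have [|||| x [x' [far close]]] := @pigeonhole_coloring R I 'I_k c (D \o lev) L.
- by rewrite card_ord.
- by move=> i; apply: D0.
- move=> i; apply: le_trans A8; rewrite ler_expR lerN2; apply: ler_peMr; first exact: ltW.
  by rewrite ler1n.
- rewrite card_ord.
  pose F r := 8 * expR (- A) * (1 / 2) ^+ r
      + 48 * A / b ^+ 4 * (r.+1%:R * (5000 / 6561) ^+ r) : R.
  have F0 r : 0 <= F r.
    rewrite addr_ge0 ?mulr_ge0 ?expR_ge0 ?exprn_ge0 ?invr_ge0 ?exprn_ge0 ?divr_ge0 ?(ltW A0) ?(ltW b0) //.
  apply: (@le_trans _ _ (\sum_(i : I) F (N - lev i)%N * (1 / 2) ^+ (N - lev i))).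
    apply: ler_sum => i _.
    have levM : (lev i <= M)%N by rewrite -ltnS ltn_ord.
    have sq_le : \sum_p c i p ^+ 2 <= 4 * 2 ^+ lev i.
      apply: (@le_trans _ _ (\sum_(p < k | inI i p) 4)).
        rewrite [leRHS]big_mkcond /=; apply: ler_sum => p _; rewrite /c.
        case: ifP => _; last by rewrite expr0n.
        have -> : 4 = 2 ^+ 2 :> R by ring.
        by rewrite -[leLHS]real_normK ?num_real // lerXn2r ?nnegrE.
      rewrite sumr_const -[leLHS]mulr_natr ler_wpM2l // -natrX ler_nat.
      have := card_ord_interval k (pos i * 2 ^ lev i) ((pos i).+1 * 2 ^ lev i).
      by rewrite -mulnBl subSnn mul1n cardsE.
    have sq_ge0 : 0 <= \sum_p c i p ^+ 2 by apply: sumr_ge0 => p _; rewrite sqr_ge0.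
    have := level_cost_le (N - lev i) b0 (ltW A0) A4 sq_ge0 sq_le.
    by rewrite subnKC // (leq_trans levM).
  rewrite -(pair_bigA _ (fun (j : J) (s : {l : 'I_M.+1 & 'I_(k %/ 2 ^ l)}) =>
    F (N - tag s)%N * (1 / 2) ^+ (N - tag s))) /=.
  rewrite sumr_const -[_ *+ _]mulr_natr.
  rewrite -(sig_big_dep (fun=> true) (fun _ _ => true)
    (fun (l : 'I_M.+1) (_ : 'I_(k %/ 2 ^ l)) => F (N - l)%N * (1 / 2) ^+ (N - l))) /=.
  (* Level [l] has at most [alpha 2^N * k / 2^l] indices, and the factor [(1/2)^(N - l)] turns this
     into [alpha k]. *)
  apply: (@le_trans _ _ (\sum_(l < M.+1) F (N - l)%N * (alpha * k%:R))).
    rewrite mulr_suml; apply: ler_sum => l _.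
    have lN : (l <= N)%N by rewrite (leq_trans _ MN) // -ltnS ltn_ord.
    rewrite sumr_const card_ord -[_ *+ _]mulr_natr -!mulrA ler_wpM2l //.
    have kl : (k %/ 2 ^ l)%:R <= k%:R / 2 ^+ l :> R.
      by rewrite ler_pdivlMr ?exprn_gt0 // -natrX -natrM ler_nat leq_trunc_div.
    have -> : alpha * k%:R = (1 / 2) ^+ (N - l) * ((k%:R / 2 ^+ l) * (alpha * 2 ^+ N)).
      rewrite -{2}(subnK lN) exprD.
      have -> : (1 / 2 : R) ^+ (N - l) = (2 ^+ (N - l))^-1 by rewrite mul1r exprVn.
      by field; rewrite !expf_neq0 ?pnatr_eq0.
    by rewrite ler_wpM2l ?exprn_ge0 ?divr_ge0 // ler_pM.
  rewrite -mulr_suml.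
  have Fsum n := level_costs_sum_le n A0 b0.
  have := sum_rev_le MN F0 Fsum.
  have ak : 0 <= alpha * k%:R by rewrite mulr_ge0 // ltW.
  move=> /(ler_wpM2r ak) /le_trans; apply.
  by rewrite mulrA ler_wpM2r.
exists x, x'; split; first by rewrite card_ord in far.
move=> j t tk.
apply: le_trans (@prefix_dyadic _ k M _ (fun l => 2 * D l) t _ kM tk _) _.
- by move=> l; rewrite mulr_ge0 // ltW.
- move=> l a lM ak; have lM1 : (l < M.+1)%N by [].
  pose i : I := (j, existT (fun l : 'I_M.+1 => 'I_(k %/ 2 ^ l)) (Ordinal lM1) (Ordinal ak)).
  apply: le_trans (close i); rewrite big_mkcond /= le_eqVlt; apply/orP; left; apply/eqP.
  congr (`| _ |); apply: eq_bigr => p _; rewrite /c /inI /pos /lev /=.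
  by case: ifP => _; rewrite ?mulr0.
rewrite -mulr_sumr -[\sum_(_ < _) _]/(\sum_(l < M.+1) b * Q * (9 / 10) ^+ (N - l)) -mulr_sumr.
have -> : \sum_(l < M.+1) (9 / 10 : R) ^+ (N - l)
    = (9 / 10) ^+ (N - M) * \sum_(l < M.+1) (9 / 10) ^+ (M - l).
  rewrite mulr_sumr; apply: eq_bigr => l _; have lM : (l <= M)%N := ltn_ord l.
  by rewrite -exprD addnBA // subnK.
have H := sum_rev_9_10 R M.
have -> : 20 * b * Num.sqrt (2 ^+ N) * (9 / 10) ^+ (N - M)
    = 2 * (b * Q * ((9 / 10) ^+ (N - M) * 10)) by rewrite /Q; ring.
by rewrite !ler_wpM2l ?exprn_ge0 ?divr_ge0 ?mulr_ge0 ?(ltW b0) ?(ltW Q0).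
Qed.

(** * From partial to full colourings of a list *)

Lemma big_take_nth (V : Type) (idx : V) (op : Monoid.com_law idx) (T : Type) (t0 : T)
    (s : seq T) (q : nat) (P : pred T) (F : T -> V) : (q <= size s)%N ->
  \big[op/idx]_(t <- take q s | P t) F t
  = \big[op/idx]_(p < size s | (p < q)%N && P (nth t0 s p)) F (nth t0 s p).
Proof.
move=> qs; rewrite (big_nth t0) size_takel // big_mkord.
rewrite (big_ord_widen_cond _ (fun p => P (nth t0 (take q s) p))
  (fun p => F (nth t0 (take q s) p)) qs).
apply: eq_big => [p|p /andP[_ pq]]; last by rewrite nth_take.
by rewrite andbC; case: ltnP => //= pq; rewrite nth_take.
Qed.

Lemma filter_take (T : Type) (a : pred T) (s : seq T) (q : nat) :
  seq.filter a (take q s) = take (count a (take q s)) (seq.filter a s).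
Proof.
rewrite -[X in _ = take _ (seq.filter a X)](cat_take_drop q s) filter_cat.
by rewrite take_size_cat // size_filter.
Qed.

Definition balanced (R : realType) (J : finType) (T : eqType) (u : J -> T -> R)
    (s : seq T) (col : pred T) (chi : T -> bool) (B : R) :=
  forall j q, `|\sum_(t <- take q s | col t) sg R (chi t) * u j t| <= B.

(** The uncoloured elements of a prefix of [s] form a prefix of the uncoloured sublist, so the two
    bounds add up. *)
Lemma balanced_combine (R : realType) (J : finType) (T : eqType) (u : J -> T -> R)
    (s : seq T) (col col' : pred T) (chi chi' : T -> bool) (B B' : R) :
  balanced u s col chi B -> balanced u (seq.filter (predC col) s) col' chi' B' ->
  balanced u s (predU col col') (fun t => if col t then chi t else chi' t) (B + B').
Proof.
move=> bal bal' j q; rewrite (bigID col) /=.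
apply: le_trans (ler_normD _ _) (lerD _ _).
  rewrite (eq_bigl col); last by move=> t; case: (col t); rewrite ?andbF.
  by under eq_bigr => t -> do [].
rewrite (eq_bigl (fun t => ~~ col t && col' t)); last first.
  by move=> t; case: (col t); rewrite ?andbF ?andbT.
rewrite (eq_bigr (fun t => sg R (chi' t) * u j t)); last first.
  by move=> t /andP[/negbTE ->].
by rewrite -big_filter_cond filter_take.
Qed.

(** Half the difference of two sign vectors vanishes where they agree and equals the first sign
    elsewhere, so the places where they differ become the coloured ones. *)
Lemma partial_balanced (R : realType) (alpha : R) : 0 < alpha ->
  exists2 b : R, 0 < b &
  forall (N M : nat) (J : finType) (T : eqType) (u : J -> T -> R) (s : seq T),
    (M <= N)%N -> uniq s -> (size s <= 2 ^ M)%N ->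
    #|J|%:R <= alpha * 2 ^+ N -> (forall j t, `|u j t| <= 2) ->
    exists (col : pred T) (chi : T -> bool),
      (4 * count (predC col) s <= 3 * size s)%N /\
      balanced u s col chi (b * Num.sqrt (2 ^+ N) * (9 / 10) ^+ (N - M)).
Proof.
move=> /prefix_partial_coloring[b b0 H]; exists b => // N M J T u s MN us sM Jle u2.
set B := b * _ * _; have B0 : 0 <= B.
  by rewrite !mulr_ge0 ?sqrtr_ge0 ?exprn_ge0 ?divr_ge0 // ltW.
case: s us sM => [|t0 s0] us sM.
  by exists pred0, (fun=> true); split=> // j q; rewrite big_pred0 ?normr0.
set s := t0 :: s0 in us sM *; have s_gt0 : (0 < size s)%N by [].
have [x [x' [far close]]] :=
  H N M (size s) J (fun j p => u j (nth t0 s p)) MN s_gt0 sM Jle (fun j p => u2 j _).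
(* Signs of positions become signs of elements, consistently because [s] is duplicate-free. *)
pose at_ (y : {ffun 'I_(size s) -> bool}) t :=
  if insub (index t s) is Some p then y p else false.
have atE y (p : 'I_(size s)) : at_ y (nth t0 s p) = y p.
  by rewrite /at_ index_uniq // valK.
exists (fun t => at_ x t != at_ x' t), (at_ x); split.
  have cntE : count (fun t => at_ x t != at_ x' t) s = #|[set p | x p != x' p]|.
    rewrite -sum1_count -{1}(take_size s) (big_take_nth _ t0) // -sum1_card.
    by apply: eq_bigl => p; rewrite ltn_ord !atE inE.
  have := count_predC (fun t => at_ x t != at_ x' t) s; rewrite cntE.
  by move: far; lia.
move=> j q; wlog qs : q / (q <= size s)%N => [hw|].
  case: (leqP q (size s)) => [/hw//|sq].
  by have := hw _ (leqnn (size s)); rewrite take_size take_oversize // ltnW.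
rewrite (big_take_nth _ t0) //=.
have := close j q qs.
rewrite [X in `|X|](_ : _ = 2 * \sum_(p < size s | (p < q)%N &&
    (at_ x (nth t0 s p) != at_ x' (nth t0 s p)))
    sg R (at_ x (nth t0 s p)) * u j (nth t0 s p)).
  rewrite normrM ger0_norm // -/B; set z := `|_|; have : 0 <= z by apply: normr_ge0.
  by clearbody z B; lra.
rewrite mulr_sumr big_mkcondr /=; apply: eq_bigr => p _; rewrite !atE /sg.
by case: (x p); case: (x' p) => /=; rewrite ?expr0 ?expr1; ring.
Qed.

(** Each round colours at least a quarter of what is left; every round is charged at the same [M],
    hence the factor [i]. *)
Lemma iterated_balanced (R : realType) (alpha : R) : 0 < alpha ->
  exists2 b : R, 0 < b &
  forall (i N M : nat) (J : finType) (T : eqType) (u : J -> T -> R) (s : seq T),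
    (M <= N)%N -> uniq s -> (size s <= 2 ^ M)%N ->
    #|J|%:R <= alpha * 2 ^+ N -> (forall j t, `|u j t| <= 2) ->
    exists (col : pred T) (chi : T -> bool),
      (4 ^ i * count (predC col) s <= 3 ^ i * size s)%N /\
      balanced u s col chi (i%:R * (b * Num.sqrt (2 ^+ N) * (9 / 10) ^+ (N - M))).
Proof.
move=> /partial_balanced[b b0 H]; exists b => // i N M J T u s MN us sM Jle u2.
set B := b * _ * _.
elim: i => [|i [col [chi [cnt bal]]]].
  exists pred0, (fun=> true); split; first by rewrite !expn0 !mul1n count_size.
  by move=> j q; rewrite big_pred0 // normr0 mul0r.
have [||col' [chi' [cnt' bal']]] := H N M J T u (seq.filter (predC col) s) MN _ _ Jle u2.
- exact: filter_uniq.
- by rewrite size_filter (leq_trans (count_size _ _)).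
exists (predU col col'), (fun t => if col t then chi t else chi' t); split; last first.
  by rewrite -natr1 mulrDl mul1r; apply: balanced_combine.
move: cnt'; rewrite count_filter size_filter.
rewrite (@eq_count _ (predI _ _) (predC (predU col col'))); last first.
  by move=> t /=; rewrite negb_or andbC.
rewrite !expnS; move: cnt; set c := count _ s; set c' := count _ s.
move=> h1 h2; apply: (@leq_trans (4 ^ i * (3 * c))).
  by rewrite mulnAC mulnC leq_mul2l h2 orbT.
by rewrite mulnCA -mulnA leq_mul2l.
Qed.

(** Three rounds leave at most [27/64 < 1/2] of the list, so [M] drops by one and the next bound
    shrinks by [9/10]: the costs form a geometric series. *)
Lemma full_balanced (R : realType) (alpha : R) : 0 < alpha ->
  exists2 C : R, 0 < C &
  forall (N M : nat) (J : finType) (T : eqType) (u : J -> T -> R) (s : seq T),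
    (M <= N)%N -> uniq s -> (size s <= 2 ^ M)%N ->
    #|J|%:R <= alpha * 2 ^+ N -> (forall j t, `|u j t| <= 2) ->
    exists chi : T -> bool,
      balanced u s predT chi (C * Num.sqrt (2 ^+ N) * (9 / 10) ^+ (N - M)).
Proof.
(* The constant solves [C = 3 b + 9/10 C]. *)
move=> /iterated_balanced[b b0 H]; exists (30 * b); first by rewrite mulr_gt0.
move=> N M J T u s MN us sM Jle u2.
set Q : R := Num.sqrt _; have Q0 : 0 <= Q := sqrtr_ge0 _.
have rho0 n : 0 <= (9 / 10 : R) ^+ n by rewrite exprn_ge0 // divr_ge0.
have bQ0 : 0 <= b * Q by rewrite mulr_ge0 // ltW.
elim: M s MN us sM => [|M IH] s MN us sM.
  (* For a list of length at most 1, one round colours everything, since [4 c <= 3] forces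
     [c = 0]. *)
  have [col [chi [cnt bal]]] := H 1%N N 0%N J T u s MN us sM Jle u2.
  have cnt0 : count (predC col) s = 0%N by move: cnt sM; rewrite expn0; lia.
  have colT : {in s, forall t, col t}.
    move=> t ts; apply: contraT => nct.
    have : has (predC col) s by apply/hasP; exists t.
    by rewrite has_count cnt0.
  exists chi => j q; rewrite big_seq_cond.
  rewrite (eq_bigl (fun t => (t \in take q s) && col t)) -?big_seq_cond; last first.
    by move=> t; apply: andb_id2l => /mem_take /colT ->.
  apply: le_trans (bal j q) _; rewrite mul1r -/Q.
  by have := mulr_ge0 bQ0 (rho0 (N - 0)%N); lra.
have [col [chi [cnt bal]]] := H 3%N N M.+1 J T u s MN us sM Jle u2.
have [||chi' bal'] := IH (seq.filter (predC col) s) (ltnW MN).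
- exact: filter_uniq.
- rewrite size_filter; move: cnt sM.
  rewrite (_ : 4 ^ 3 = 64)%N // (_ : 3 ^ 3 = 27)%N // expnS; set X := (2 ^ M)%N; lia.
exists (fun t => if col t then chi t else chi' t).
have := balanced_combine bal bal'; rewrite -/Q => bal2 j q.
have := bal2 j q; rewrite (eq_bigl xpredT); last by move=> t /=; rewrite orbT.
move=> /le_trans; apply.
rewrite -(subnSK MN) exprS; have := mulr_ge0 bQ0 (rho0 (N - M.+1)%N); lra.
Qed.

(** * Orderings with small prefix sums *)

Definition prefix_le (R : realType) (J : finType) (T : eqType) (u : J -> T -> R)
    (s : seq T) (D : R) :=
  forall j q, `|\sum_(t <- take q s) u j t| <= D.

Lemma take_filter_ex (T : Type) (a : pred T) (s : seq T) (q : nat) :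
  exists q', take q (seq.filter a s) = seq.filter a (take q' s).
Proof.
elim: s q => [|t s IH] q; first by exists 0%N.
case: q => [|q]; first by exists 0%N; rewrite !take0.
rewrite /=; case at_: (a t).
  by have [q' e] := IH q; exists q'.+1; rewrite /= at_ e.
by have [q' e] := IH q.+1; exists q'.+1; rewrite /= at_ e.
Qed.

(** The indicator of a class is [(1 + chi) / 2] or [(1 - chi) / 2] in terms of signs, and a prefix
    of the class comes from a prefix of [s]. *)
Lemma prefix_le_color_class (R : realType) (J : finType) (T : eqType) (u : J -> T -> R)
    (s : seq T) (chi : T -> bool) (D E : R) (b : bool) :
  prefix_le u s D -> balanced u s predT chi E ->
  prefix_le u (seq.filter (fun t => chi t == b) s) ((D + E) / 2).
Proof.
move=> pre bal j q.
have [q' ->] := take_filter_ex (fun t => chi t == b) s q.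
rewrite big_filter (_ : \sum_(_ <- _ | _) _ = (\sum_(t <- take q' s) u j t
    + sg R b * \sum_(t <- take q' s) sg R (chi t) * u j t) / 2); last first.
  rewrite mulr_sumr -big_split mulr_suml big_mkcond /=; apply: eq_bigr => t _.
  by case: (chi t); case: b => /=; rewrite /sg ?expr0 ?expr1; field.
rewrite normrM [`|2^-1|]ger0_norm ?invr_ge0 // ler_wpM2r ?invr_ge0 //.
apply: le_trans (ler_normD _ _) (lerD (pre _ _) _).
by rewrite normrM norm_sg mul1r; apply: bal.
Qed.

(* Chobanyan's transference: as the total is 0, a prefix of the list reaching
   into the reversed second class is minus a prefix of that class. *)
Lemma prefix_le_rearrange (R : realType) (J : finType) (T : eqType) (u : J -> T -> R)
    (s : seq T) (chi : T -> bool) (D E : R) :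
  (forall j, \sum_(t <- s) u j t = 0) ->
  prefix_le u s D -> balanced u s predT chi E ->
  prefix_le u (seq.filter chi s ++ rev (seq.filter (predC chi) s)) ((D + E) / 2).
Proof.
move=> u0 pre bal j q.
have := prefix_le_color_class true pre bal j.
rewrite (eq_filter (a2 := chi)) => [h1|t]; last by rewrite eqb_id.
have := prefix_le_color_class false pre bal j.
rewrite (eq_filter (a2 := predC chi)) => [h2|t]; last by rewrite eqbF_neg.
rewrite take_cat; case: ltnP => _; first exact: h1.
rewrite take_rev; set m := (_ - _)%N; set B := seq.filter (predC chi) s.
have := u0 j; rewrite -(perm_big _ (permEl (perm_filterC chi s))) /= -/B.
rewrite !big_cat /= -{1}(cat_take_drop m B) big_cat /= => tot.
have -> : \sum_(t <- rev (drop m B)) u j t = \sum_(t <- drop m B) u j t.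
  by apply: perm_big; rewrite perm_rev.
have -> : \sum_(t <- seq.filter chi s) u j t + \sum_(t <- drop m B) u j t
    = - \sum_(t <- take m B) u j t.
  by apply/eqP; rewrite -addr_eq0 addrC addrCA tot.
by rewrite normrN; apply: h2.
Qed.

(** Transference maps a bound [D] to [(D + C Q) / 2], so the excess over [C Q] halves each time.
    From the trivial [2 * 2^N] it falls to 2 after [N] rounds, and [Q >= 1] absorbs that. *)
Lemma rearrangement (R : realType) (alpha : R) : 0 < alpha ->
  exists2 C : R, 0 < C &
  forall (N : nat) (J : finType) (T : eqType) (u : J -> T -> R) (s : seq T),
    uniq s -> (size s <= 2 ^ N)%N ->
    #|J|%:R <= alpha * 2 ^+ N -> (forall j t, `|u j t| <= 2) ->
    (forall j, \sum_(t <- s) u j t = 0) ->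
    exists2 s', perm_eq s' s & prefix_le u s' (C * Num.sqrt (2 ^+ N)).
Proof.
move=> /full_balanced[C C0 H]; exists (C + 2); first by rewrite addr_gt0.
move=> N J T u s us sN Jle u2 u0; set Q : R := Num.sqrt _.
have Q1 : 1 <= Q by rewrite -sqrtr1 ler_wsqrtr // exprn_ege1 // ler1n.
suff [s' ps' pre] : exists2 s', perm_eq s' s &
    prefix_le u s' (C * Q + 2 * (2 ^+ N / 2 ^+ N)).
  exists s' => // j q; apply: le_trans (pre j q) _.
  by rewrite divff ?expf_neq0 ?pnatr_eq0 //; nra.
elim: {2}N => [|i [s' ps' pre]].
  exists s => // j q; apply: le_trans (ler_norm_sum _ _ _) _.
  apply: (@le_trans _ _ (\sum_(t <- take q s) 2)); first exact: ler_sum.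
  rewrite big_const_seq count_predT iter_addr_0 -[_ *+ _]mulr_natr expr0 divr1.
  apply: (@le_trans _ _ (2 * 2 ^+ N)); last first.
    by rewrite lerDr; apply: mulr_ge0; [exact: ltW|exact: le_trans ler01 Q1].
  rewrite ler_wpM2l // -natrX ler_nat; apply: leq_trans sN.
  by rewrite -{2}(cat_take_drop q s) size_cat leq_addr.
have us' : uniq s' by rewrite (perm_uniq ps').
have ss' : (size s' <= 2 ^ N)%N by rewrite (perm_size ps').
have [chi bal] := H N N J T u s' (leqnn N) us' ss' Jle u2.
rewrite subnn expr0 mulr1 -/Q in bal.
have u0' j : \sum_(t <- s') u j t = 0 by rewrite (perm_big _ ps').
exists (seq.filter chi s' ++ rev (seq.filter (predC chi) s')).
  apply: perm_trans ps'; apply: perm_trans _ (permEl (perm_filterC chi s')).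
  by rewrite perm_cat2l perm_rev.
move=> j q; apply: le_trans (prefix_le_rearrange u0' pre bal j q) _.
by rewrite exprS invfM; lra.
Qed.

Lemma prefix_le_take (R : realType) (J : finType) (T : eqType) (u : J -> T -> R)
    (s : seq T) (D : R) (k : nat) :
  prefix_le u s D -> prefix_le u (take k s) D.
Proof. by move=> pre j q; rewrite -take_min; apply: pre. Qed.

(** * Halving the list to shrink its prefix sums *)

(** Each step keeps half of the list, inside one colour class. At length at most [2^(N - h)] the
    colouring costs only [C' Q (9/10)^h], so the bound decays geometrically. *)
Lemma halving (R : realType) (alpha : R) : 0 < alpha ->
  exists2 K : R, 0 < K &
  forall (N h : nat) (J : finType) (T : eqType) (u : J -> T -> R) (s : seq T),
    uniq s -> (size s <= 2 ^ N)%N -> (h <= N)%N ->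
    #|J|%:R <= alpha * 2 ^+ N -> (forall j t, `|u j t| <= 2) ->
    (forall j, \sum_(t <- s) u j t = 0) ->
    exists s', [/\ uniq s', (size s <= 2 ^ h * size s')%N, (size s' <= 2 ^ (N - h))%N
      & prefix_le u s' (K * Num.sqrt (2 ^+ N) * (9 / 10) ^+ h)].
Proof.
move=> alpha0; have [C C0 HC] := rearrangement alpha0.
have [C' C'0 HC'] := full_balanced alpha0.
(* This [K] satisfies [(K + C') / 2 <= 9/10 K]. *)
exists (C + 2 * C'); first by rewrite addr_gt0 // mulr_gt0.
move=> N h J T u s us sN hN Jle u2 u0; set Q : R := Num.sqrt _.
have Q0 : 0 <= Q := sqrtr_ge0 _.
have CQ := mulr_ge0 (ltW C0) Q0; have CQ' := mulr_ge0 (ltW C'0) Q0.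
elim: h hN => [_|h IH hN].
  have [s' ps' pre] := HC N J T u s us sN Jle u2 u0.
  exists s'; rewrite (perm_uniq ps') (perm_size ps') subn0 mul1n; split=> // j q.
  by apply: le_trans (pre j q) _; rewrite -/Q expr0 mulr1; lra.
have [s' [us' ss' s'N pre]] := IH (ltnW hN).
have [chi bal] := HC' N (N - h)%N J T u s' (leq_subr _ _) us' s'N Jle u2.
rewrite subKn 1?ltnW // -/Q in bal.
have [b hb] : exists b, (uphalf (size s') <= count (fun t => chi t == b) s')%N.
  have := count_predC (fun t => chi t == true) s'.
  rewrite (@eq_count _ (predC _) (fun t => chi t == false)); last first.
    by move=> t /=; case: (chi t).
  case: (leqP (uphalf (size s')) (count (fun t => chi t == true) s')); first by exists true.
  by move=> ? ?; exists false; lia.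
(* Cutting the larger class to half of [s'], rounded up, preserves both size bounds. *)
exists (take (uphalf (size s')) (seq.filter (fun t => chi t == b) s')).
rewrite size_takel ?size_filter //; split.
- by rewrite take_uniq ?filter_uniq.
- by apply: leq_trans ss' _; rewrite expnS -mulnA mulnCA leq_mul2l; apply/orP; right; lia.
- by move: s'N; rewrite -(subnSK hN) expnS; set X := (2 ^ _)%N; lia.
apply: prefix_le_take => j q.
apply: le_trans (prefix_le_color_class b pre bal j q) _.
have rho0 : 0 <= (9 / 10 : R) ^+ h by rewrite exprn_ge0 // divr_ge0.
have := mulr_ge0 CQ rho0; have := mulr_ge0 CQ' rho0; rewrite exprS.
by set z := _ ^+ h; lra.
Qed.

Lemma exprn_9_10_small (R : realType) (e : R) : 0 < e ->
  exists h, (9 / 10) ^+ h <= e.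
Proof.
move=> e0; pose h := (Num.truncn (9 / e)).+1; exists h.
(* The left side is nonincreasing in [n], as [9/10 (n + 10) <= n + 9]. *)
have H n : (9 / 10 : R) ^+ n * (n%:R + 9) <= 9.
  elim: n => [|n IH]; first by rewrite expr0 mul1r add0r.
  apply: le_trans IH; rewrite exprS -mulrA mulrCA ler_wpM2l ?exprn_ge0 ?divr_ge0 //.
  by rewrite -natr1; have := ler0n R n; lra.
have h9 : 9 / e < h%:R by apply: truncnS_gt.
have := H h; rewrite -ler_pdivlMr ?addr_gt0 // => /le_trans; apply.
rewrite ler_pdivrMr ?addr_gt0 //; move: h9; rewrite ltr_pdivrMr //; nra.
Qed.

(** [N] is the scale with [2^(N-1) <= n < 2^N], while the number [h] of halvings does not depend on
    [n], so a fixed fraction [2^-h] of the columns survives. *)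
Lemma slow_sequence (R : realType) (alpha eps : R) : 0 < alpha -> 0 < eps ->
  exists2 d : R, 0 < d & exists n0 : nat,
  forall (n m : nat) (u : 'I_m -> 'I_n -> R),
    (n0 <= n)%N -> m%:R <= alpha * n%:R -> (forall j i, `|u j i| <= 2) ->
    (forall j, \sum_i u j i = 0) ->
    exists s : seq 'I_n, [/\ uniq s, d * n%:R <= (size s)%:R,
      (size s)%:R <= eps * n%:R & prefix_le u s (eps * Num.sqrt n%:R)].
Proof.
move=> alpha0 eps0; have [K K0 H] := halving alpha0.
(* The summand [2 K] serves the prefix bound, as [sqrt(2^N) <= 2 sqrt n]; the summand 2 serves the
   length, as [2^(N - h) <= 2 n (9/10)^h]. *)
have [h hle] : exists h, (9 / 10) ^+ h <= eps / (2 * K + 2).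
  by apply: exprn_9_10_small; rewrite divr_gt0 // addr_gt0 // mulr_gt0.
rewrite ler_pdivlMr in hle; last by rewrite addr_gt0 // mulr_gt0.
have rho0 : 0 <= (9 / 10 : R) ^+ h by rewrite exprn_ge0 // divr_ge0.
exists (2 ^- h); first by rewrite invr_gt0 exprn_gt0.
exists (2 ^ h)%N => n m u hn mn u2 u0.
have n0 : (0 < n)%N by apply: leq_trans hn; rewrite expn_gt0.
have /andP[Nn nN] := trunc_log_bounds (isT : (1 < 2)%N) n0.
set N := (trunc_log 2 n).+1 in nN.
have hN : (h <= N)%N by rewrite ltnW // -(@ltn_exp2l 2) // (leq_ltn_trans hn).
have Qn : 2 ^+ N <= 2 * n%:R :> R by rewrite exprS ler_wpM2l // -natrX ler_nat.
have nQ : n%:R <= 2 ^+ N :> R by rewrite -natrX ler_nat ltnW.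
have [|||s [us ns sN pre]] := H N h _ _ u (enum 'I_n) (enum_uniq _) _ hN _ u2.
- by rewrite size_enum_ord ltnW.
- by rewrite card_ord (le_trans mn) // ler_wpM2l // ltW.
- by move=> j; rewrite big_enum /=; apply: u0.
exists s; split=> //.
- rewrite mulrC ler_pdivrMr ?exprn_gt0 // -natrX -natrM ler_nat mulnC.
  by rewrite size_enum_ord in ns.
- apply: (@le_trans _ _ (2 ^+ N / 2 ^+ h)).
    rewrite ler_pdivlMr ?exprn_gt0 // -(subnK hN) exprD ler_wpM2r ?exprn_ge0 //.
    by rewrite -natrX ler_nat.
  apply: (@le_trans _ _ (2 * n%:R * (9 / 10) ^+ h)).
    apply: ler_pM => //; rewrite ?exprn_ge0 ?invr_ge0 ?exprn_ge0 //.
    by rewrite -exprVn lerXn2r ?nnegrE ?invr_ge0 ?divr_ge0 //; lra.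
  rewrite mulrAC ler_wpM2r //; apply: le_trans hle.
  by have := mulr_ge0 rho0 (ltW K0); lra.
move=> j q; apply: le_trans (pre j q) _.
apply: (@le_trans _ _ (K * (2 * Num.sqrt n%:R) * (9 / 10) ^+ h)).
  apply: ler_wpM2r => //; apply: ler_wpM2l; first exact: ltW.
  have -> : 2 * Num.sqrt n%:R = Num.sqrt (2 ^+ 2 * n%:R) :> R.
    by rewrite sqrtrM ?sqr_ge0 // sqrtr_sqr ger0_norm.
  rewrite ler_wsqrtr //.
  by apply: le_trans Qn _; rewrite ler_wpM2r // expr2; lra.
rewrite mulrAC mulrA ler_wpM2r ?sqrtr_ge0 //; apply: le_trans hle.
by lra.
Qed.

(** * Paths of single flips inside a cluster *)

Definition flip_at (n : nat) (X : 'cV[bool]_n) (s : seq 'I_n) : 'cV[bool]_n :=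
  \col_i (if i \in s then ~~ X i 0 else X i 0).

Lemma hamming_flip_at (n : nat) (X : 'cV[bool]_n) (s : seq 'I_n) :
  uniq s -> hamming X (flip_at X s) = size s.
Proof.
move=> us; rewrite /hamming -(card_uniqP us); apply: eq_card => i.
by rewrite inE mxE; case: (i \in s); rewrite ?eqxx //; case: (X i 0).
Qed.

Lemma hamming_flip_at_rcons (n : nat) (X : 'cV[bool]_n) (s : seq 'I_n) (i : 'I_n) :
  i \notin s -> hamming (flip_at X s) (flip_at X (rcons s i)) = 1%N.
Proof.
move=> ins; rewrite /hamming; apply: etrans (cards1 i); apply: eq_card => j.
rewrite !inE !mxE mem_rcons inE; case: (eqVneq j i) => [->|_] /=.
  by rewrite (negbTE ins); case: (X i 0).
by rewrite eqxx.
Qed.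

Lemma connect_flip_at (n : nat) (S : {set 'cV[bool]_n}) (X : 'cV[bool]_n) (s : seq 'I_n) :
  uniq s -> (forall q, flip_at X (take q s) \in S) ->
  connect (adjacent_in S) X (flip_at X s).
Proof.
elim/last_ind: s => [|s i IH].
  move=> _ _; rewrite (_ : flip_at X [::] = X) ?connect0 //.
  by apply/matrixP => i j; rewrite mxE ord1.
rewrite rcons_uniq => /andP[ins us] inS.
have takeS q : take q s = take (minn q (size s)) (rcons s i).
  by rewrite take_min -cats1 take_size_cat.
apply: (connect_trans (IH us _)) => [q|]; first by rewrite takeS.
apply: connect1; rewrite /adjacent_in /= hamming_flip_at_rcons // eqxx andbT.
have := inS (size s); rewrite -[X in take _ X]cats1 take_size_cat // => ->.
by have := inS (size (rcons s i)); rewrite take_size.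
Qed.

(** The successive flips form a path in [S] from [X], the case [q = 0], to a point at distance
    [size s]. *)
Lemma in_wide_cluster_flip_at (R : realType) (d : R) (n : nat) (S : {set 'cV[bool]_n})
    (X : 'cV[bool]_n) (s : seq 'I_n) :
  uniq s -> d * n%:R <= (size s)%:R -> (forall q, flip_at X (take q s) \in S) ->
  in_wide_cluster d S X.
Proof.
move=> us ds inS; have XY := connect_flip_at us inS.
have XS : X \in S.
  have := inS 0%N; rewrite take0 (_ : flip_at X [::] = X) //.
  by apply/matrixP => i j; rewrite mxE ord1.
have YS : flip_at X s \in S by have := inS (size s); rewrite take_size.
pose C := [set Y in S | connect (adjacent_in S) X Y].
apply/existsP; exists C; apply/andP; split; first by apply/imsetP; exists X.
rewrite inE XS connect0 /=; apply: le_trans ds _; rewrite ler_nat.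
rewrite -(hamming_flip_at X us) /diameter.
apply: leq_trans (leq_bigmax_cond (F := fun X => \max_(Y in C) hamming X Y) X _).
  by apply: (leq_bigmax_cond (F := hamming X)); rewrite inE YS.
by rewrite inE XS connect0.
Qed.

Lemma mulmx_pm (R : pzRingType) (m n : nat) (G : 'M[bool]_(m, n)) (X : 'cV[bool]_n) (j : 'I_m) :
  (pm R G *m pm R X) j 0 = \sum_i sg R (G j i) * sg R (X i 0).
Proof. by rewrite mxE; apply: eq_bigr => i _; rewrite !mxE. Qed.

Lemma mulmx_pm_flip_at (R : pzRingType) (m n : nat) (G : 'M[bool]_(m, n))
    (X : 'cV[bool]_n) (s : seq 'I_n) (j : 'I_m) : uniq s ->
  (pm R G *m pm R (flip_at X s)) j 0
  = (pm R G *m pm R X) j 0 - (\sum_(i <- s) sg R (G j i) * sg R (X i 0)) *+ 2.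
Proof.
move=> us; rewrite !mulmx_pm (big_uniq _ us) /= [X in _ - X *+ 2]big_mkcond /= -sumrMnl -sumrB.
apply: eq_bigr => i _; rewrite mxE; case: (i \in s); last by rewrite mul0rn subr0.
by rewrite sgN mulrN mulr2n opprD addNKr.
Qed.

(** Split the products [G_ji X_i] of a row into their mean and a centred part. Flipping a fraction
    [theta] of the coordinates scales the row by [1 - 2 theta] through the mean; the centred part
    contributes twice a prefix sum. *)
Lemma flip_margins (R : realType) (alpha eps : R) : 0 < alpha -> 0 < eps ->
  exists2 d : R, 0 < d & exists n0 : nat,
  forall (n m : nat) (G : 'M[bool]_(m, n)) (X : 'cV[bool]_n),
    (n0 <= n)%N -> m%:R <= alpha * n%:R ->
    exists s : seq 'I_n, [/\ uniq s, d * n%:R <= (size s)%:R &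
      forall q j, exists2 theta : R, 0 <= theta <= eps &
        `|(pm R G *m pm R (flip_at X (take q s))) j 0
          - (1 - 2 * theta) * (pm R G *m pm R X) j 0| <= 2 * eps * Num.sqrt n%:R].
Proof.
move=> alpha0 eps0; have [d d0 [n0 H]] := slow_sequence alpha0 eps0.
exists d => //; exists n0.+1 => n m G X n0n mn.
have n_gt0 : 0 < n%:R :> R by rewrite ltr0n (leq_trans _ n0n).
pose v j i := sg R (G j i) * sg R (X i 0).
have v1 j i : `|v j i| = 1 by rewrite normrM !norm_sg mulr1.
pose r j := \sum_i v j i; pose u j i := v j i - r j / n%:R.
have rn j : `|r j / n%:R| <= 1.
  rewrite normrM normfV normr_nat ler_pdivrMr // mul1r.
  apply: le_trans (ler_norm_sum _ _ _) _.
  by under eq_bigr do rewrite v1; rewrite sumr_const card_ord.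
have u2 j i : `|u j i| <= 2.
  by apply: le_trans (ler_normB _ _) _; rewrite v1; have := rn j; lra.
have u0 j : \sum_i u j i = 0.
  rewrite sumrB sumr_const card_ord -[_ *+ _]mulr_natr divfK ?subrr //.
  by rewrite gt_eqF.
have [s [us ds seps pre]] := H n m u (ltnW n0n) mn u2 u0.
exists s; split=> // q j; exists ((size (take q s))%:R / n%:R).
  rewrite divr_ge0 //= ler_pdivrMr //; apply: le_trans seps.
  by rewrite ler_nat -{2}(cat_take_drop q s) size_cat leq_addr.
rewrite mulmx_pm_flip_at ?take_uniq // mulmx_pm -/(r j).
rewrite [X in `|X|](_ : _ = - (2 * \sum_(i <- take q s) u j i)); last first.
  rewrite [in RHS]sumrB big_const_seq count_predT iter_addr_0 -/(v j).
  rewrite -[_ *+ size _]mulr_natr -[_ *+ 2]mulr_natr /v; ring.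
by rewrite normrN normrM ger0_norm // -mulrA ler_wpM2l //; apply: pre.
Qed.

(** * Probability, and the two models *)

Lemma Pr_setT (R : realType) (m n : nat) (E : {set 'M[bool]_(m, n)}) :
  (forall G, G \in E) -> Pr R E = 1.
Proof.
move=> ET; have -> : E = [set: 'M[bool]_(m, n)] by apply/setP => G; rewrite ET inE.
rewrite /Pr sumr_const prodr_const prodr_const !card_ord cardsT card_mx card_bool.
by rewrite -exprM -[_ *+ (_ ^ _)]mulr_natr natrX mulnC exprVn mulVf // expf_neq0 // pnatr_eq0.
Qed.

(** No solution is exceptional once [n >= n0], so [delta = 0] works and the event is then
    certain. *)
Lemma whp_most_eventually (R : realType) (alpha : R)
    (T : forall m n : nat, 'M[bool]_(m, n) -> {set 'cV[bool]_n})
    (P : forall m n : nat, 'M[bool]_(m, n) -> pred 'cV[bool]_n) (n0 : nat) :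
  (forall n (G : 'M[bool]_(nrows alpha n, n)) X, (n0 <= n)%N ->
     X \in T _ _ G -> P _ _ G X) ->
  whp_most alpha T P.
Proof.
move=> all_good; exists (fun=> 0); first exact: cvg_cst.
apply: cvg_near_cst; exists n0 => // n /= n0n.
apply: Pr_setT => G; rewrite inE mul0r.
rewrite (_ : [set X in _ | _] = finset.set0) ?cards0 //.
apply/setP => X; rewrite !inE; apply/negP => /andP[/(all_good _ _ _ n0n) ->] //.
Qed.

Lemma nrows_le (R : realType) (alpha : R) (n : nat) :
  0 < alpha -> (nrows alpha n)%:R <= alpha * n%:R.
Proof. by move=> alpha0; rewrite truncn_le mulr_ge0 // ltW. Qed.

Theorem theorem2p3 (R : realType) :
  (forall kappa' kappa alpha : R,
     0 < kappa' -> kappa' < kappa -> 0 < alpha ->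
     exists2 d : R, 0 < d &
       whp_most alpha
         (fun m n (G : 'M[bool]_(m, n)) => sbp_sol kappa' G)
         (fun m n (G : 'M[bool]_(m, n)) => in_wide_cluster d (sbp_sol kappa G)))
  /\
  (forall kappa' kappa alpha : R,
     kappa < kappa' -> 0 < alpha ->
     exists2 d : R, 0 < d &
       whp_most alpha
         (fun m n (G : 'M[bool]_(m, n)) => abp_sol kappa' G)
         (fun m n (G : 'M[bool]_(m, n)) => in_wide_cluster d (abp_sol kappa G))).
Proof.
split=> [kappa' kappa alpha kappa'0 lt_kappa alpha0|kappa' kappa alpha lt_kappa alpha0].
(* [eps <= 1/2] keeps [1 - 2 theta] in [[0, 1]], so scaling does not enlarge a row in absolute
   value; the other bound gives [2 eps <= kappa - kappa']. *)
- pose eps := Num.min (1 / 2) ((kappa - kappa') / 2).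
  have eps0 : 0 < eps by rewrite lt_min !divr_gt0 // subr_gt0.
  have [d d0 [n0 H]] := flip_margins alpha0 eps0.
  exists d => //; apply: (@whp_most_eventually _ _ _ _ n0.+1) => n G X n0n.
  have n_gt0 : 0 < Num.sqrt n%:R :> R by rewrite sqrtr_gt0 ltr0n (leq_trans _ n0n).
  rewrite inE => /forallP solX.
  have [s [us ds close]] := H n _ G X (ltnW n0n) (nrows_le n alpha0).
  apply: (in_wide_cluster_flip_at us ds) => q.
  rewrite inE; apply/forallP => j; have [theta /andP[t0 t1]] := close q j.
  have := solX j; rewrite ![_^-1 * _]mulrC !ler_pdivrMr //.
  have : eps <= (kappa - kappa') / 2 by rewrite ge_min lexx orbT.
  have : eps <= 1 / 2 by rewrite ge_min lexx.
  set r := (_ *m pm R X) j 0; set r' := (_ *m _) j 0; set Q := Num.sqrt _ in n_gt0 *.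
  move=> e1 e2 hr hr'.
  have : `|(1 - 2 * theta) * r| <= `|r|.
    by rewrite normrM ler_piMl // ger0_norm; lra.
  have := ler_normD (r' - (1 - 2 * theta) * r) ((1 - 2 * theta) * r); rewrite subrK.
  have : eps * Q <= (kappa - kappa') / 2 * Q by rewrite ler_wpM2r // ltW.
  by lra.
(* Scaling can now lower the margin, by [2 theta kappa']; the total loss [2 theta kappa' + 2 eps] is
   at most [2 eps (1 + |kappa'|) <= kappa' - kappa]. *)
pose eps := Num.min (1 / 2) ((kappa' - kappa) / (2 * (1 + `|kappa'|))).
have k0 : 0 < 2 * (1 + `|kappa'|) by rewrite mulr_gt0 // ltr_pwDl.
have eps0 : 0 < eps by rewrite lt_min !divr_gt0 // subr_gt0.
have [d d0 [n0 H]] := flip_margins alpha0 eps0.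
exists d => //; apply: (@whp_most_eventually _ _ _ _ n0.+1) => n G X n0n.
have n_gt0 : 0 < Num.sqrt n%:R :> R by rewrite sqrtr_gt0 ltr0n (leq_trans _ n0n).
rewrite inE => /forallP solX.
have [s [us ds close]] := H n _ G X (ltnW n0n) (nrows_le n alpha0).
apply: (in_wide_cluster_flip_at us ds) => q.
rewrite inE; apply/forallP => j; have [theta /andP[t0 t1]] := close q j.
have := solX j; rewrite ![_^-1 * _]mulrC !ler_pdivlMr //.
have : eps <= (kappa' - kappa) / (2 * (1 + `|kappa'|)) by rewrite ge_min lexx orbT.
rewrite ler_pdivlMr //.
have : eps <= 1 / 2 by rewrite ge_min lexx.
set r := (_ *m pm R X) j 0; set r' := (_ *m _) j 0; set Q := Num.sqrt _ in n_gt0 *.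
move=> e1 e2 hr; rewrite ler_norml => /andP[hr' _].
have h1 : (1 - 2 * theta) * (kappa' * Q) <= (1 - 2 * theta) * r.
  by rewrite ler_wpM2l //; lra.
have h2 : theta * kappa' <= eps * `|kappa'|.
  apply: le_trans (ler_norm _) _; rewrite normrM ger0_norm //.
  by rewrite ler_wpM2r.
have h3 : (2 * (theta * kappa') + 2 * eps) * Q <= (kappa' - kappa) * Q.
  by apply: ler_wpM2r; [exact: ltW|lra].
by lra.
Qed.
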